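(* Let $X$ and $Y$ be real Banach spaces such that $X$ or $Y$ has the approximation property. Then the set of elementary tensors $\mathcal{T} = \{x \otimes y : x \in X,\ y \in Y\}$ is weakly closed in the projective tensor product $X \widehat{\otimes}_\pi Y$.
   Context: For real Banach spaces $X, Y$, $\mathcal{B}(X\times Y)$ is the Banach space of continuous bilinear forms on $X \times Y$ with norm $\|B\| = \sup_{x\in B_X, y\in B_Y}|B(x,y)|$, where $B_X$, $B_Y$ are the closed unit balls. For $x\in X$, $y \in Y$, the elementary tensor $x\otimes y \in \mathcal{B}(X\times Y)^*$ is given by $\langle x\otimes y, B\rangle = B(x,y)$. The projective tensor product $X\widehat{\otimes}_\pi Y$ is the norm-closed linear span of $\{x\otimes y : x\in X, y\in Y\}$ in $\mathcal{B}(X\times Y)^*$; its dual is isometrically $\mathcal{B}(X\times Y)$. A Banach space $X$ has the approximation property if for every $\varepsilon>0$ and every compact $K\subset X$ there is a bounded finite rank operator $T: X\to X$ with $\|Tx-x\|\le\varepsilon$ for all $x\in K$. *)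

(* Defs.v *)
From HB Require Import structures.
From mathcomp Require Import all_boot all_order all_algebra.
From mathcomp Require Import all_classical all_reals all_analysis.
Set Implicit Arguments.
Unset Strict Implicit.
Unset Printing Implicit Defensive.
Import Order.TTheory GRing.Theory Num.Theory.
Import numFieldNormedType.Exports.
Local Open Scope classical_set_scope.
Local Open Scope ring_scope.

Definition unit_ball {R : realType} (E : normedModType R) : set E :=
  [set x | `|x| <= 1].
Arguments unit_ball {R} E _ /.

Section LinearSpan.
Context {R : realType} {E : lmodType R}.
Implicit Types (A : set E) (u v : E).

Definition lspan A : set E :=
  [set u | exists s : seq (R * E),
    (forall p, p \in s -> A p.2) /\ u = \sum_(p <- s) p.1 *: p.2].

Lemma lspan0 A : lspan A 0.
Proof. by exists [::]; split=> //; rewrite big_nil. Qed.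

Lemma lspanD A u v : lspan A u -> lspan A v -> lspan A (u + v).
Proof.
move=> [s [sA ->]] [t [tA ->]]; exists (s ++ t); rewrite big_cat; split=> //; move=> p.
by rewrite mem_cat => /orP[]; [exact: sA|exact: tA].
Qed.

Lemma lspanZ A (a : R) u : lspan A u -> lspan A (a *: u).
Proof.
move=> [s [sA ->]]; exists [seq (a * p.1, p.2) | p <- s]; split.
  by move=> _ /mapP[p ps ->] /=; exact: sA ps.
by rewrite big_map scaler_sumr; apply: eq_bigr => p _; rewrite scalerA.
Qed.

Lemma sub_lspan A : A `<=` lspan A.
Proof.
move=> u Au; exists [:: (1, u)]; split; last by rewrite big_seq1 scale1r.
by move=> p; rewrite inE => /eqP ->.
Qed.

End LinearSpan.

Section SupNorm.
Context {R : realType} {T : Type}.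
Implicit Types (D : set T) (f g : T -> R).

Definition supnorm D f : R := sup [set `|f x| | x in D].

Definition bounded_on D f := exists M, forall x, D x -> `|f x| <= M.

Lemma supnorm_has_sup D f : D !=set0 -> bounded_on D f ->
  has_sup [set `|f x| | x in D].
Proof.
move=> [x Dx] [M fM]; split; first by exists `|f x|, x.
by exists M => _ [y Dy <-]; exact: fM.
Qed.

Lemma le_supnorm D f x : bounded_on D f -> D x -> `|f x| <= supnorm D f.
Proof.
move=> fb Dx; apply: sup_upper_bound; last by exists x.
by apply: supnorm_has_sup fb; exists x.
Qed.

Lemma supnorm_le D f M : D !=set0 -> (forall x, D x -> `|f x| <= M) ->
  supnorm D f <= M.
Proof.
move=> [x Dx] fM; apply: ge_sup; first by exists `|f x|, x.
by move=> _ [y Dy <-]; exact: fM.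
Qed.

Lemma supnormD D f g : D !=set0 -> bounded_on D f -> bounded_on D g ->
  supnorm D (fun x => f x + g x) <= supnorm D f + supnorm D g.
Proof.
move=> D0 fb gb; apply: supnorm_le => // x Dx.
by rewrite (le_trans (ler_normD _ _))// lerD// le_supnorm.
Qed.

Lemma supnormZ_le D f (a : R) : D !=set0 -> bounded_on D f ->
  supnorm D (fun x => a * f x) <= `|a| * supnorm D f.
Proof.
move=> D0 fb; apply: supnorm_le => // x Dx.
by rewrite normrM ler_wpM2l// le_supnorm.
Qed.

Lemma bounded_onZ D f (a : R) : bounded_on D f ->
  bounded_on D (fun x => a * f x).
Proof.
by move=> [M fM]; exists (`|a| * M) => x Dx; rewrite normrM ler_wpM2l// fM.
Qed.

Lemma supnormZ D f (a : R) : D !=set0 -> bounded_on D f ->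
  supnorm D (fun x => a * f x) = `|a| * supnorm D f.
Proof.
move=> D0 fb; apply/eqP; rewrite eq_le supnormZ_le//=.
have [->|a0] := eqVneq a 0.
  rewrite normr0 mul0r; case: (D0) => x Dx.
  by rewrite (le_trans (normr_ge0 (0 * f x)))// (@le_supnorm D (fun x => 0 * f x))//;
    exact: bounded_onZ.
rewrite -ler_pdivlMl ?normr_gt0// -normfV.
apply: le_trans (supnormZ_le a^-1 D0 (bounded_onZ a fb)).
by rewrite (_ : (fun x => _) = f)//; apply/funext => x; rewrite mulKf.
Qed.

End SupNorm.

Section Dual.
Context {R : realType} (E : normedModType R).

Definition is_dual : {pred E -> R} :=
  [pred f : E -> R | `[< linear f /\ continuous f >]].

Record dual := Dual { dual_fun :> E -> R ; _ : dual_fun \in is_dual }.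

HB.instance Definition _ := [isSub for dual_fun].
HB.instance Definition _ := [Choice of dual by <:].

Lemma dualP (f : dual) : linear f /\ continuous f.
Proof. by case: f => f /= /asboolP. Qed.

Lemma is_dual_submod_closed : submod_closed is_dual.
Proof.
split=> [|a f g /asboolP[lf cf] /asboolP[lg cg]]; apply/asboolP; split.
- by move=> a x y; rewrite /= scaler0 addr0.
- exact: cst_continuous.
- move=> b x y; rewrite !fctE lf lg !scalerDr !scalerA (mulrC a b).
  by rewrite addrACA.
- move=> x; apply: cvgD; last exact: cg.
  by apply: cvgZr; exact: cf.
Qed.
HB.instance Definition _ :=
  GRing.isSubmodClosed.Build R (E -> R) is_dual is_dual_submod_closed.
HB.instance Definition _ := [SubChoice_isSubLmodule of dual by <:].

HB.instance Definition _ (f : dual) :=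
  GRing.isLinear.Build R E R *:%R f (proj1 (dualP f)).

Definition dual_norm (f : dual) : R := supnorm (unit_ball E) f.

Lemma unit_ball0 : unit_ball E !=set0.
Proof. by exists 0; rewrite /= normr0 ler01. Qed.

Lemma dual_bounded (f : dual) : bounded_on (unit_ball E) f.
Proof.
have [_ /(_ 0) cf] := dualP f.
have /bounded_funP/(_ 1)[M fM] := continuous_linear_bounded 0 cf.
by exists M.
Qed.

Lemma dual_normD f g : dual_norm (f + g) <= dual_norm f + dual_norm g.
Proof. exact: supnormD unit_ball0 (dual_bounded f) (dual_bounded g). Qed.

Lemma dual_normZ (a : R) f : dual_norm (a *: f) = `|a| * dual_norm f.
Proof. exact: supnormZ unit_ball0 (dual_bounded f). Qed.

Lemma dual_norm0_eq0 f : dual_norm f = 0 -> f = 0.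
Proof.
move=> f0; apply/val_inj/funext => x /=.
have fball y : unit_ball E y -> f y = 0.
  move=> /(le_supnorm (dual_bounded f)); rewrite -/(dual_norm f) f0.
  by rewrite normr_le0 => /eqP.
have [->|x0] := eqVneq x 0; first by rewrite raddf0.
have : f (`|x|^-1 *: x) = 0.
  by apply: fball; rewrite /= normrZ normfV normr_id mulVf ?normr_eq0.
rewrite linearZ/= => /eqP; rewrite scaler_eq0 invr_eq0 normr_eq0 (negbTE x0).
by move=> /eqP.
Qed.

HB.instance Definition _ :=
  Lmodule_isNormed.Build R dual dual_normD dual_normZ dual_norm0_eq0.

End Dual.
Arguments is_dual {R} E.

(* The coarsest topology on E making every element of the topological dual
   continuous; not the library's initial topology of a single map, which was
   formerly called the weak topology. *)
Definition weak {R : realType} (E : normedModType R) : topologicalType :=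
  sup_topology (fun f : dual E => Topological.on (initial_topology f)).

Definition weakly_closed {R : realType} (E : normedModType R) (A : set E) :=
  @closed (weak E) A.

Section BilinearForms.
Context {R : realType} (X Y : normedModType R).

Definition is_bform : {pred X -> Y -> R} :=
  [pred B : X -> Y -> R | `[< [/\ forall y, linear (B^~ y),
    forall x, linear (B x) & continuous (fun p : X * Y => B p.1 p.2)] >]].

Record bform := Bform { bform_fun :> X -> Y -> R ; _ : bform_fun \in is_bform }.

HB.instance Definition _ := [isSub for bform_fun].
HB.instance Definition _ := [Choice of bform by <:].

Lemma bformP (B : bform) : [/\ forall y, linear (B^~ y),
  forall x, linear (B x) & continuous (fun p : X * Y => B p.1 p.2)].
Proof. by case: B => B /= /asboolP. Qed.

Lemma is_bform_submod_closed : submod_closed is_bform.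
Proof.
split=> [|a B C /asboolP[lB rB cB] /asboolP[lC rC cC]]; apply/asboolP; split.
- by move=> ? ? ? ?; rewrite /= scaler0 addr0.
- by move=> ? ? ? ?; rewrite /= scaler0 addr0.
- exact: cst_continuous.
- move=> y b x1 x2; rewrite !fctE lB lC !scalerDr !scalerA (mulrC a b).
  by rewrite addrACA.
- move=> x b y1 y2; rewrite !fctE rB rC !scalerDr !scalerA (mulrC a b).
  by rewrite addrACA.
- move=> x; apply: cvgD; last exact: cC.
  by apply: cvgZr; exact: cB.
Qed.
HB.instance Definition _ :=
  GRing.isSubmodClosed.Build R (X -> Y -> R) is_bform is_bform_submod_closed.
HB.instance Definition _ := [SubChoice_isSubLmodule of bform by <:].

Definition bform_norm (B : bform) : R :=
  supnorm (unit_ball X `*` unit_ball Y) (fun p => B p.1 p.2).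

Let unit_balls0 : unit_ball X `*` unit_ball Y !=set0.
Proof. by exists (0, 0); split; rewrite /= normr0 ler01. Qed.

Lemma bformZ (B : bform) (a b : R) x y : B (a *: x) (b *: y) = a * b * B x y.
Proof.
have [lB rB _] := bformP B.
have B0 z : B 0 z = 0.
  by apply: (addrI (B 0 z)); rewrite addr0 -{1}[B 0 z]scale1r -lB scaler0 addr0.
have B0' z : B z 0 = 0.
  by apply: (addrI (B z 0)); rewrite addr0 -{1}[B z 0]scale1r -rB scaler0 addr0.
rewrite -[a *: x]addr0 lB B0 addr0 -[b *: y]addr0 rB B0' addr0.
by rewrite -mulrA.
Qed.

Lemma bform_bounded (B : bform) :
  bounded_on (unit_ball X `*` unit_ball Y) (fun p => B p.1 p.2).
Proof.
have [_ _ /(_ (0, 0))/= cB] := bformP B.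
have B00 : B 0 0 = 0.
  by rewrite -(scale0r (0 : X)) -[X in B _ X](scale0r (0 : Y)) bformZ !mul0r.
have := cB; move/cvgrPdist_lt => /(_ 1 ltr01)/nbhs_ballP[e /= e0 Be].
pose d := e / 2; have d0 : 0 < d by rewrite divr_gt0.
exists ((d * d)^-1) => -[x y] [/= x1 y1].
rewrite -[leRHS]mulr1 ler_pdivlMl ?mulr_gt0//.
rewrite -[X in X * _](@gtr0_norm _ (d * d)) ?mulr_gt0// -normrM -bformZ ltW//.
have := Be (d *: x, d *: y); rewrite /= B00 sub0r normrN; apply.
have db (V : normedModType R) (z : V) : `|z| <= 1 -> ball 0 e (d *: z).
  move=> z1; rewrite -ball_normE /= sub0r normrN normrZ gtr0_norm//.
  rewrite (@le_lt_trans _ _ d)// ?ler_piMr// 1?ltW//.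
  by rewrite /d ltr_pdivrMr// ltr_pMr// ltr1n.
by split; exact: db.
Qed.

Lemma bform_normD B C : bform_norm (B + C) <= bform_norm B + bform_norm C.
Proof. exact: supnormD unit_balls0 (bform_bounded B) (bform_bounded C). Qed.

Lemma bform_normZ (a : R) B : bform_norm (a *: B) = `|a| * bform_norm B.
Proof. exact: supnormZ unit_balls0 (bform_bounded B). Qed.

Lemma bform_le_unit (B : bform) x y : `|x| <= 1 -> `|y| <= 1 ->
  `|B x y| <= bform_norm B.
Proof. by move=> x1 y1; exact: (@le_supnorm _ _ _ _ (x, y) (bform_bounded B)). Qed.

Lemma bform_le (B : bform) x y : `|B x y| <= bform_norm B * `|x| * `|y|.
Proof.
have [->|x0] := eqVneq x 0.
  by rewrite -(scale0r (0 : X)) -[y]scale1r bformZ !mul0r normr0 scale0r normr0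
    mulr0 mul0r.
have [->|y0] := eqVneq y 0.
  by rewrite -(scale0r (0 : Y)) -[x]scale1r bformZ mulr0 mul0r normr0 scale0r
    normr0 mulr0.
have := @bform_le_unit B (`|x|^-1 *: x) (`|y|^-1 *: y).
rewrite !normrZ !normfV !normr_id !mulVf ?normr_eq0// lexx bformZ.
rewrite normrM -invfM normfV normrM !normr_id => /(_ isT isT).
by rewrite ler_pdivrMl ?mulr_gt0 ?normr_gt0// mulrC mulrA.
Qed.

Lemma bform_norm0_eq0 B : bform_norm B = 0 -> B = 0.
Proof.
move=> B0; apply/val_inj/funext => x; apply/funext => y /=.
by apply/eqP; rewrite -normr_le0 (le_trans (bform_le B x y))// B0 !mul0r.
Qed.

HB.instance Definition _ :=
  Lmodule_isNormed.Build R bform bform_normD bform_normZ bform_norm0_eq0.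

End BilinearForms.
Arguments is_bform {R} X Y.

Section ProjectiveTensorProduct.
Context {R : realType} (X Y : normedModType R).

Lemma bform_eval_is_dual (x : X) (y : Y) :
  (fun B : bform X Y => B x y) \in is_dual (bform X Y).
Proof.
apply/asboolP.
have lev : linear (fun B : bform X Y => B x y) by [].
pose f : {linear bform X Y -> R} := HB.pack (fun B : bform X Y => B x y)
  (GRing.isLinear.Build _ _ _ _ _ lev).
split=> //; apply: (@bounded_linear_continuous _ _ _ f).
apply/bounded_funP => r; exists (r * `|x| * `|y|) => B Br.
by rewrite (le_trans (bform_le B x y))// !ler_wpM2r.
Qed.

Definition bform_eval (x : X) (y : Y) : dual (bform X Y) :=
  Dual (bform_eval_is_dual x y).

Definition elementary_span : set (dual (bform X Y)) :=
  lspan (range (fun p : X * Y => bform_eval p.1 p.2)).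

Definition is_ptensor : {pred dual (bform X Y)} :=
  [pred u | `[< closure elementary_span u >]].

Record ptensor := Ptensor {
  ptensor_val :> dual (bform X Y) ; _ : ptensor_val \in is_ptensor }.

HB.instance Definition _ := [isSub for ptensor_val].
HB.instance Definition _ := [Choice of ptensor by <:].

Lemma is_ptensor_submod_closed : submod_closed is_ptensor.
Proof.
set S := elementary_span.
have clP u : closure S u <->
    forall e, 0 < e -> exists2 v, S v & `|u - v| < e.
  split=> [+ e e0|Su U /nbhs_ballP[e /= e0 eU]].
    by move=> /(_ _ (nbhsx_ballx u e e0))[v [Sv]]; rewrite -ball_normE; exists v.
  by have [v Sv uv] := Su _ e0; exists v; split=> //; apply: eU; rewrite -ball_normE.
split=> [|a u v /asboolP/clP Su /asboolP/clP Sv]; apply/asboolP/clP => e e0.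
  by exists 0; [exact: lspan0|rewrite subrr normr0].
have a0 : 0 < 1 + `|a| by rewrite ltr_wpDr.
have [u' Su' uu'] : exists2 w, S w & `|u - w| < e / 2 / (1 + `|a|).
  by apply: Su; rewrite !divr_gt0.
have [v' Sv' vv'] := Sv (e / 2) (divr_gt0 e0 (ltr0Sn _ _)).
exists (a *: u' + v'); first by apply: lspanD => //; exact: lspanZ.
rewrite opprD addrACA -scalerBr (le_lt_trans (ler_normD _ _))//.
rewrite [ltRHS]splitr ler_ltD// normrZ.
move: uu'; rewrite ltr_pdivlMr// => /ltW; apply: le_trans.
by rewrite mulrC ler_wpM2l// lerDr.
Qed.
HB.instance Definition _ := GRing.isSubmodClosed.Build R (dual (bform X Y))
  is_ptensor is_ptensor_submod_closed.
HB.instance Definition _ := [SubChoice_isSubLmodule of ptensor by <:].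

Definition ptensor_norm (u : ptensor) : R := `|ptensor_val u|.

Lemma ptensor_normD u v :
  ptensor_norm (u + v) <= ptensor_norm u + ptensor_norm v.
Proof. exact: ler_normD. Qed.

Lemma ptensor_normZ (a : R) u : ptensor_norm (a *: u) = `|a| * ptensor_norm u.
Proof. exact: normrZ. Qed.

Lemma ptensor_norm0_eq0 u : ptensor_norm u = 0 -> u = 0.
Proof. by move=> /normr0_eq0 u0; exact: val_inj. Qed.

HB.instance Definition _ := Lmodule_isNormed.Build R ptensor
  ptensor_normD ptensor_normZ ptensor_norm0_eq0.

Lemma bform_eval_is_ptensor (x : X) (y : Y) : bform_eval x y \in is_ptensor.
Proof.
by apply/asboolP/subset_closure/sub_lspan; exists (x, y).
Qed.

Definition tensor (x : X) (y : Y) : ptensor :=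
  Ptensor (bform_eval_is_ptensor x y).

Lemma tensorE (x : X) (y : Y) (B : bform X Y) : tensor x y B = B x y.
Proof. by []. Qed.

End ProjectiveTensorProduct.

Definition finite_rank {R : realType} {E F : lmodType R} (T : E -> F) :=
  exists s : seq F, range T = lspan [set` s].

Definition approximation_property {R : realType} (E : normedModType R) :=
  forall (e : R) (K : set E), 0 < e -> compact K ->
  exists T : {linear E -> E}, [/\ bounded_near T (nbhs 0), finite_rank T &
    forall x, K x -> `|T x - x| <= e].

(* Main.v *)
From HB Require Import structures.
Require Import Defs.
From mathcomp Require Import all_boot all_order all_algebra.
From mathcomp Require Import all_classical all_reals all_analysis.
From mathcomp Require Import ring lra.
Set Implicit Arguments.
Unset Strict Implicit.
Unset Printing Implicit Defensive.
Import Order.TTheory GRing.Theory Num.Theory.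
Import numFieldNormedType.Exports.
Local Open Scope classical_set_scope.
Local Open Scope ring_scope.

(** If X or Y has the approximation property, then among all elements u of the
    projective tensor product the elementary tensors are exactly those whose
    2 x 2 minors on rank-one forms vanish:
      u (f # g) * u (f' # g') = u (f # g') * u (f' # g),
    where f # g denotes the bilinear form (x, y) |-> f x * g y. Each of these
    equations involves four weakly continuous functionals of u, so the set they
    cut out is weakly closed.

    An elementary tensor satisfies the equations because
    (x (x) y) (f # g) = f x * g y. For the converse ([tensor_minors]), suppose
    u (f0 # g0) is nonzero. The functional f |-> u (f # g0) is evaluation at a
    point x of X, since it is a limit of evaluations and X is complete
    ([ptensor_slice]); similarly g |-> u (f0 # g) is evaluation at some y. The
    minors then say that u agrees on all f # g with x tensored with a multiple
    of y. So it remains to know that an element of the tensor product vanishing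
    on all f # g is zero ([rank1_separating]), and this is where the
    approximation property enters.

    For that, every u is controlled by compact sets ([ptensor_compact_control]):
    there are compact K and L such that |u B| is at most a constant times the
    supremum of |B| over K x L. If T has finite rank and is close to the
    identity on K, then B and B(T -, -) are close on K x L, and the latter is a
    finite sum of forms f # g, hence killed by u; so u B is arbitrarily small.

    The compact sets come from writing u as a series of finite sums of
    elementary tensors with rapidly decreasing total cost, the cost of
    x (x) y being |x| |y|. Since the norm of u is a dual norm, that such
    economical sums exist ([tensor_approx]) is a duality statement: it follows
    from the Hahn-Banach theorem applied to a functional which trades the cost
    of a finite sum against its distance to u. Hahn-Banach itself is obtained
    from Zorn's lemma, as the statement that minimal sublinear functionals are
    linear. *)

(** * The Hahn-Banach theorem *)

Section HahnBanach.
Context {R : realType} {E : lmodType R}.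
Implicit Types (p q : E -> R) (a x y : E).

(** The inequality for positive scalars already forces positive homogeneity, see
    [sublinearZ]; asking only for it shortens the verifications. *)
Definition sublinear p :=
  (forall x y, p (x + y) <= p x + p y) /\
  (forall (t : R) x, 0 < t -> p (t *: x) <= t * p x).

Lemma sublinearZ p (t : R) x : sublinear p -> 0 < t -> p (t *: x) = t * p x.
Proof.
move=> [_ pZ] t0; apply/eqP; rewrite eq_le pZ//=.
rewrite -ler_pdivlMl// -[in leLHS](scalerK (lt0r_neq0 t0) x).
by rewrite pZ// invr_gt0.
Qed.

Lemma sublinear0 p : sublinear p -> p 0 = 0.
Proof.
move=> sp; have := @sublinearZ p 2 0 sp (ltr0Sn _ _).
by rewrite scaler0; lra.
Qed.

Lemma sublinearN p x : sublinear p -> - p (- x) <= p x.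
Proof.
move=> sp; have := (proj1 sp) x (- x); rewrite subrr sublinear0//.
lra.
Qed.

(** The largest sublinear functional below p whose value at - a is at most - p a.
    A minimal p must coincide with it, which yields additivity. *)
Definition infdir p a x : R :=
  inf [set p (x + t *: a) - t * p a | t in [set t : R | 0 <= t]].

Lemma infdir_le p a x (t : R) : sublinear p -> 0 <= t ->
  infdir p a x <= p (x + t *: a) - t * p a.
Proof.
move=> sp t0; apply: ge_inf; last by exists t.
exists (- p (- x)) => _ [s /= s0 <-].
have -> : s * p a = p (s *: a).
  move: s0; rewrite le_eqVlt => /orP[/eqP <-|s0]; last by rewrite sublinearZ.
  by rewrite scale0r mul0r sublinear0.
have := (proj1 sp) (x + s *: a) (- x); rewrite addrAC subrr add0r; lra.
Qed.

Lemma le_infdir p a x (m : R) :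
  (forall t : R, 0 <= t -> m <= p (x + t *: a) - t * p a) -> m <= infdir p a x.
Proof.
move=> H; apply: lb_le_inf; first by exists (p (x + 0 *: a) - 0 * p a), 0 => /=.
by move=> _ [t /= t0 <-]; exact: H.
Qed.

Lemma infdir_sublinear p a : sublinear p -> sublinear (infdir p a).
Proof.
move=> sp; split=> [x y|s x s0].
  rewrite -lerBlDr; apply: le_infdir => t t0.
  rewrite lerBlDr -lerBlDl; apply: le_infdir => u u0.
  rewrite lerBlDl; apply: le_trans (infdir_le _ _ sp (addr_ge0 t0 u0)) _.
  have := (proj1 sp) (x + t *: a) (y + u *: a).
  rewrite addrACA -scalerDl; lra.
rewrite -ler_pdivrMl//; apply: le_infdir => t t0.
rewrite ler_pdivrMl//.
apply: le_trans (infdir_le _ _ sp (mulr_ge0 (ltW s0) t0)) _.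
by rewrite -scalerA -scalerDr sublinearZ// mulrBr mulrA.
Qed.

(** By minimality [infdir q a] is q itself; its value at x is bounded by the term
    t = 1 of the infimum, which gives the reverse of subadditivity. *)
Lemma minimal_sublinear_additive q : sublinear q ->
  (forall q', sublinear q' -> (forall x, q' x <= q x) -> q' = q) ->
  forall x a, q (x + a) = q x + q a.
Proof.
move=> sq qmin x a; apply/eqP; rewrite eq_le (proj1 sq)/=.
have qa : infdir q a = q.
  apply: qmin; first exact: infdir_sublinear.
  move=> y; apply: le_trans (infdir_le a y sq (lexx 0)) _.
  by rewrite scale0r addr0 mul0r subr0.
have := infdir_le a x sq ler01.
by rewrite qa scale1r mul1r lerBrDr.
Qed.

Lemma additive_sublinear_linear q : sublinear q ->
  (forall x y, q (x + y) = q x + q y) -> linear q.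
Proof.
move=> sq qD t x y; rewrite qD; congr (_ + _).
have qN z : q (- z) = - q z.
  by apply/eqP; rewrite -subr_eq0 opprK -qD addNr sublinear0.
have [t0|t0|->] := ltgtP t 0; last by rewrite !scale0r sublinear0.
  rewrite -[t]opprK scaleNr qN sublinearZ ?oppr_gt0//.
  by rewrite scaleNr.
exact: sublinearZ.
Qed.

(** Zorn's lemma for the reverse pointwise order. The pointwise infimum of a
    chain is finite because - p (- x) bounds every member from below, and it is
    subadditive because two members of a chain are comparable. *)
Lemma exists_minimal_sublinear p : sublinear p ->
  exists q, [/\ sublinear q, (forall x, q x <= p x) &
    forall q', sublinear q' -> (forall x, q' x <= q x) -> q' = q].
Proof.
move=> sp; pose T := {q | sublinear q /\ forall x, q x <= p x}.
pose leT (q q' : T) := `[< forall x : E, sval q' x <= sval q x >].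
have [||||[q [sq qp]] qmax] := @Zorn T leT.
- by move=> q; apply/asboolP.
- by move=> q r s /asboolP qr /asboolP rs; apply/asboolP => x; exact: le_trans (qr x).
- move=> [q Hq] [r Hr] /asboolP /= qr /asboolP /= rq; apply: eq_exist.
  by apply/funext => x; apply/eqP; rewrite eq_le rq qr.
- move=> A totA; have [[q0 Aq0]|A0] := pselect (exists q : T, A q); last first.
    by exists (exist _ p (conj sp (fun x => lexx (p x)))) => q Aq; case: A0; exists q.
  pose m x : R := inf ((fun q : T => sval q x) @` A).
  have mle (q : T) x : A q -> m x <= sval q x.
    move=> Aq; apply: ge_inf; last by exists q.
    exists (- p (- x)) => _ [r Ar <-]; have [sr rp] := svalP r.
    by rewrite (le_trans _ (sublinearN x sr))// lerN2.
  have m_ge x (c : R) : (forall q : T, A q -> c <= sval q x) -> c <= m x.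
    move=> H; apply: lb_le_inf; first by exists (sval q0 x), q0.
    by move=> _ [q Aq <-]; exact: H.
  suff sm : sublinear m.
    have mp x : m x <= p x by apply: le_trans (mle q0 x Aq0) _; exact: (proj2 (svalP q0)).
    exists (exist _ m (conj sm mp)) => q Aq; apply/asboolP => x; exact: mle.
  split=> [x y|t x t0].
    rewrite -lerBlDr; apply/m_ge => q Aq; rewrite lerBlDr -lerBlDl.
    apply/m_ge => r Ar; rewrite lerBlDl.
    have [/asboolP qr|/asboolP rq] := totA _ _ Aq Ar.
      apply: le_trans (mle r _ Ar) _.
      by rewrite (le_trans (proj1 (proj1 (svalP r)) x y))// lerD.
    apply: le_trans (mle q _ Aq) _.
    by rewrite (le_trans (proj1 (proj1 (svalP q)) x y))// lerD.
  rewrite -ler_pdivrMl//; apply/m_ge => q Aq; rewrite ler_pdivrMl//.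
  by apply: le_trans (mle q _ Aq) _; apply: (proj2 (proj1 (svalP q))).
exists q; split=> // q' sq' q'q.
have q'p x : q' x <= p x := le_trans (q'q x) (qp x).
by have /(congr1 sval) := qmax (exist _ q' (conj sq' q'p)) (asboolT q'q).
Qed.

(** A minimal functional below [infdir p a], rather than below p, takes the
    prescribed value at a: [infdir p a (- a)] is at most - p a. *)
Theorem Hahn_Banach p a : sublinear p ->
  exists f : E -> R, [/\ linear f, forall x, f x <= p x & f a = p a].
Proof.
move=> sp.
have [f [sf fp fmin]] := exists_minimal_sublinear (infdir_sublinear a sp).
have lf := additive_sublinear_linear sf (minimal_sublinear_additive sf fmin).
have f_le x : f x <= p x.
  apply: le_trans (fp x) _; apply: le_trans (infdir_le a x sp (lexx 0)) _.
  by rewrite scale0r addr0 mul0r subr0.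
exists f; split=> //; apply/eqP; rewrite eq_le f_le/=.
have := le_trans (fp (- a)) (infdir_le a (- a) sp ler01).
rewrite scale1r mul1r addNr sublinear0// sub0r.
have := @sublinearN f (- a) sf; rewrite opprK; lra.
Qed.

End HahnBanach.

(** * Bounded linear functionals and bounded bilinear forms *)

Section DualSpace.
Context {R : realType} {E : normedModType R}.
Implicit Types (f : dual E) (x : E).

Lemma dual_le f x : `|f x| <= `|f| * `|x|.
Proof.
have [->|x0] := eqVneq x 0; first by rewrite raddf0 !normr0 mulr0.
have := @le_supnorm _ _ _ _ (`|x|^-1 *: x) (dual_bounded f).
rewrite /= normrZ normfV normr_id mulVf ?normr_eq0// lexx => /(_ isT).
by rewrite linearZ normrM normfV normr_id ler_pdivrMl ?normr_gt0// mulrC.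
Qed.

Lemma dual_norm_le f (M : R) : 0 <= M -> (forall x, `|f x| <= M * `|x|) -> `|f| <= M.
Proof.
move=> M0 fM; apply: supnorm_le; first exact: unit_ball0.
by move=> x /= x1; rewrite (le_trans (fM x))// ler_piMr.
Qed.

Lemma bounded_linear_dual (h : E -> R) (M : R) : linear h ->
  (forall x, `|h x| <= M * `|x|) -> exists f : dual E, forall x, f x = h x.
Proof.
move=> lh hM.
pose g : {linear E -> R} := HB.pack h (GRing.isLinear.Build _ _ _ _ _ lh).
suff hP : h \in is_dual E by exists (Dual hP).
apply/asboolP; split=> //; apply: (@bounded_linear_continuous _ _ _ g).
apply/bounded_funP => r; exists (`|M| * `|r|) => x xr; rewrite (le_trans (hM x))//.
apply: le_trans (ler_norm _) _; rewrite normrM ler_wpM2l// normr_id.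
exact: le_trans (ler_norm r).
Qed.

Lemma norming_functional x : exists f : dual E, `|f| <= 1 /\ f x = `|x|.
Proof.
have sn : sublinear (fun z : E => `|z|).
  by split=> [y z|t y t0]; [exact: ler_normD|rewrite normrZ gtr0_norm].
have [h [lh hle hx]] := Hahn_Banach x sn.
have habs y : `|h y| <= 1 * `|y|.
  rewrite mul1r ler_norml hle andbT lerNl.
  have /(_ (- y)) := hle; rewrite normrN; apply: le_trans.
  have := lh (-1) y 0; rewrite addr0 !scaleN1r => ->.
  have := lh (-1) 0 0; rewrite scaler0 addr0 scaleN1r addNr => ->.
  by rewrite addr0.
have [f fE] := bounded_linear_dual lh habs.
exists f; split; last by rewrite fE.
by apply: dual_norm_le => // y; rewrite fE.
Qed.

End DualSpace.

Section BoundedBilinear.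
Context {R : realType} {X Y : normedModType R}.

(** Boundedness gives joint continuity through
    b x0 y0 - b x y = b (x0 - x) y0 + b x (y0 - y). *)
Lemma bounded_bilinear_bform (b : X -> Y -> R) (M : R) :
  (forall y, linear (b^~ y)) -> (forall x, linear (b x)) ->
  (forall x y, `|b x y| <= M * `|x| * `|y|) ->
  exists B : bform X Y, forall x y, B x y = b x y.
Proof.
move=> lb rb bM; suff bP : b \in is_bform X Y by exists (Bform bP).
apply/asboolP; split=> // -[x0 y0]; apply/cvgrPdist_lt => e e0.
have bBl x x' y : b (x - x') y = b x y - b x' y.
  by rewrite addrC -scaleN1r lb scaleN1r addrC.
have bBr x y y' : b x (y - y') = b x y - b x y'.
  by rewrite addrC -scaleN1r rb scaleN1r addrC.
pose c := `|M| * (`|x0| + `|y0| + 1) + 1.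
have c0 : 0 < c by rewrite ltr_wpDl// mulr_ge0// !addr_ge0.
pose d := Order.min 1 (e / c).
have d0 : 0 < d by rewrite lt_min ltr01 divr_gt0.
have d1 : d <= 1 by rewrite ge_min lexx.
have dc : d * c <= e by rewrite -ler_pdivlMr// ge_min lexx orbT.
apply: filterS (nbhsx_ballx ((x0, y0) : X * Y) d d0) => -[x y] [] /=.
rewrite -!ball_normE /= => xd yd.
have -> : b x0 y0 - b x y = b (x0 - x) y0 + b x (y0 - y).
  by rewrite bBl bBr addrA subrK.
have xle : `|x| <= `|x0| + 1.
  have -> : x = x0 - (x0 - x) by rewrite opprB addrCA subrr addr0.
  by rewrite (le_trans (ler_normB _ _))// lerD2l (le_trans (ltW xd)).
have bM' u v : `|b u v| <= `|M| * (`|u| * `|v|).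
  by rewrite (le_trans (bM u v))// -mulrA ler_wpM2r ?mulr_ge0// ler_norm.
apply: le_lt_trans (ler_normD _ _) _.
apply: le_lt_trans (lerD (bM' _ _) (bM' _ _)) _.
rewrite -mulrDr.
have H : `|x0 - x| * `|y0| + `|x| * `|y0 - y| <= d * (`|x0| + `|y0| + 1).
  apply: (@le_trans _ _ (d * `|y0| + (`|x0| + 1) * d)).
    by apply: lerD; [rewrite ler_wpM2r// ltW|rewrite ler_pM// ltW].
  by rewrite le_eqVlt; apply/orP; left; apply/eqP; ring.
apply: le_lt_trans (ler_wpM2l (normr_ge0 M) H) _.
apply: lt_le_trans dc; rewrite mulrCA ltr_pM2l// ltrDl ltr01//.
Qed.

Lemma norm_bform_le (B : bform X Y) x y : `|B x y| <= `|B| * `|x| * `|y|.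
Proof. exact: bform_le. Qed.

Lemma bform_norm_le (B : bform X Y) (M : R) : 0 <= M ->
  (forall x y, `|B x y| <= M * `|x| * `|y|) -> `|B| <= M.
Proof.
move=> M0 BM; apply: supnorm_le; first by exists (0, 0); split; rewrite /= normr0 ler01.
move=> [x y] [/= x1 y1]; rewrite (le_trans (BM x y))// -mulrA ler_piMr//.
by rewrite mulr_ile1.
Qed.

Lemma rank1_subproof (f : dual X) (g : dual Y) :
  exists B : bform X Y, forall x y, B x y = f x * g y.
Proof.
apply: (@bounded_bilinear_bform _ (`|f| * `|g|)).
- by move=> y t x x'; rewrite linearP/= mulrDl -mulrA.
- by move=> x t y y'; rewrite linearP/= mulrDr mulrCA.
by move=> x y; rewrite normrM -[leRHS]mulrA mulrACA ler_pM ?dual_le.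
Qed.

(** The form written f # g above. *)
Definition rank1 (f : dual X) (g : dual Y) : bform X Y := projT1 (cid (rank1_subproof f g)).

Lemma rank1E f g x y : rank1 f g x y = f x * g y.
Proof. exact: (projT2 (cid (rank1_subproof f g))). Qed.

Lemma rank1_norm f g : `|rank1 f g| <= `|f| * `|g|.
Proof.
apply: bform_norm_le; first by rewrite mulr_ge0.
by move=> x y; rewrite rank1E normrM -[leRHS]mulrA mulrACA ler_pM ?dual_le.
Qed.

End BoundedBilinear.

(** * Economical approximation by finite sums of elementary tensors *)

Section ProjectiveNorm.
Context {R : realType} {X Y : normedModType R}.
Implicit Types (s : seq (X * Y)) (u v : ptensor X Y) (B : bform X Y).

Lemma ptensor_ext u v : (forall B, u B = v B) -> u = v.
Proof. by move=> uv; apply/val_inj/val_inj/funext. Qed.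

Lemma bform_ext (B C : bform X Y) : (forall x y, B x y = C x y) -> B = C.
Proof. by move=> BC; apply/val_inj/funext => x; apply/funext => y; exact: BC. Qed.

Lemma ptensor_le u B : `|u B| <= `|u| * `|B|.
Proof. exact: dual_le. Qed.

(** A sequence of pairs stands for a formal sum of elementary tensors; scalars
    are absorbed in the first components. *)
Definition tsum s : ptensor X Y := \sum_(p <- s) tensor p.1 p.2.

(** The infimum of [tcost] over all representations of a tensor is its
    projective norm. *)
Definition tcost s : R := \sum_(p <- s) `|p.1| * `|p.2|.

Lemma tsum_cons p s : tsum (p :: s) = tensor p.1 p.2 + tsum s.
Proof. by rewrite /tsum big_cons. Qed.

Lemma tsumE s B : tsum s B = \sum_(p <- s) B p.1 p.2.
Proof.
elim: s => [|p s IH]; first by rewrite /tsum !big_nil.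
by rewrite tsum_cons big_cons -IH.
Qed.

Lemma tsum_cat s t : tsum (s ++ t) = tsum s + tsum t.
Proof. exact: big_cat. Qed.

Lemma tcost_cat s t : tcost (s ++ t) = tcost s + tcost t.
Proof. exact: big_cat. Qed.

Lemma tcost_ge0 s : 0 <= tcost s.
Proof. by apply: sumr_ge0 => p _; rewrite mulr_ge0. Qed.

Definition tscale (a : R) s := [seq (a *: p.1, p.2) | p <- s].

Lemma bformZl B (a : R) x y : B (a *: x) y = a * B x y.
Proof. by rewrite -[in LHS](scale1r y) bformZ mulr1. Qed.

Lemma tsum_scale (a : R) s : tsum (tscale a s) = a *: tsum s.
Proof.
apply: ptensor_ext => B; rewrite [RHS](_ : _ = a * tsum s B)// !tsumE big_map mulr_sumr.
by apply: eq_bigr => p _; rewrite /= bformZl.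
Qed.

Lemma tcost_scale (a : R) s : tcost (tscale a s) = `|a| * tcost s.
Proof.
rewrite /tcost big_map mulr_sumr.
by apply: eq_bigr => p _; rewrite /= normrZ mulrA.
Qed.

(** The tensor product is by definition a closure of the span of elementary
    tensors. *)
Lemma tsum_dense u (d : R) : 0 < d -> exists s, `|u - tsum s| < d.
Proof.
move=> d0; case: u => v /[dup] /asboolP cv vP.
have [w [[t [tP wE]] vw]] := cv _ (nbhsx_ballx v d d0).
have [s sw] : exists s, ptensor_val (tsum s) = w.
  rewrite {}wE {vw}; elim: t tP => [|p t IH] tP.
    by exists [::]; rewrite /tsum !big_nil.
  have [q qt|s sE] := IH; first by apply: tP; rewrite inE qt orbT.
  have [[x y] _ /= xyE] := tP p (mem_head _ _).
  exists ((p.1 *: x, y) :: s); rewrite big_cons -sE -xyE tsum_cons /=.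
  apply/val_inj/funext => B /=.
  by rewrite [LHS](_ : _ = B (p.1 *: x) y + tsum s B)// bformZl.
exists s; move: vw; rewrite -ball_normE /= -sw.
by [].
Qed.

(** The infimal convolution of the projective norm with c times the norm. Unlike
    the projective norm of finite sums it is defined on the whole tensor product,
    so that Hahn-Banach applies without any reference to subspaces; a large c
    forces near-optimal sums to be close to u. *)
Definition relaxed_pi (c : R) u : R := inf [set tcost s + c * `|u - tsum s| | s in setT].

Lemma relaxed_pi_le c u s : 0 <= c -> relaxed_pi c u <= tcost s + c * `|u - tsum s|.
Proof.
move=> c0; apply: ge_inf; last by exists s.
by exists 0 => _ [t _ <-]; rewrite addr_ge0 ?tcost_ge0// mulr_ge0.
Qed.

Lemma le_relaxed_pi c u (m : R) :
  (forall s, m <= tcost s + c * `|u - tsum s|) -> m <= relaxed_pi c u.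
Proof.
move=> H; apply: lb_le_inf; first by exists (tcost [::] + c * `|u - tsum [::]|), [::].
by move=> _ [s _ <-]; exact: H.
Qed.

Lemma relaxed_pi_sublinear c : 0 <= c -> sublinear (relaxed_pi c).
Proof.
move=> c0; split=> [u v|a u a0].
  rewrite -lerBlDr; apply: le_relaxed_pi => s; rewrite lerBlDr -lerBlDl.
  apply: le_relaxed_pi => t; rewrite lerBlDl.
  apply: le_trans (relaxed_pi_le _ (s ++ t) c0) _.
  rewrite tcost_cat tsum_cat addrACA lerD2l -mulrDr ler_wpM2l//.
  by rewrite opprD addrACA ler_normD.
rewrite -ler_pdivrMl//; apply: le_relaxed_pi => s; rewrite ler_pdivrMl//.
apply: le_trans (relaxed_pi_le _ (tscale a s) c0) _.
rewrite tcost_scale tsum_scale -scalerBr normrZ gtr0_norm//.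
by rewrite mulrDr mulrCA.
Qed.

(** Hahn-Banach gives a linear h below [relaxed_pi c] with equality at u. On
    elementary tensors it is bounded by |x| |y|, so it defines a bilinear form B
    of norm at most 1; by density and continuity h u = u B, which is at most the
    norm of u. *)
Lemma relaxed_pi_le_norm c u : 0 <= c -> relaxed_pi c u <= `|u|.
Proof.
move=> c0; have [h [lh hle hu]] := Hahn_Banach u (relaxed_pi_sublinear c0).
have hD v w : h (v + w) = h v + h w by have := lh 1 v w; rewrite !scale1r.
have h0 : h 0 = 0 by apply: (addrI (h 0)); rewrite -hD !addr0.
have hZ a v : h (a *: v) = a * h v by have := lh a v 0; rewrite h0 !addr0.
have hN v : h (- v) = - h v by rewrite -scaleN1r hZ mulN1r.
have htens x y : h (tensor x y) <= `|x| * `|y|.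
  apply: le_trans (hle _) _; apply: le_trans (relaxed_pi_le _ [:: (x, y)] c0) _.
  by rewrite /tcost /tsum !big_seq1 subrr normr0 mulr0 addr0.
have tensorDl (a : R) x x' y :
    tensor (a *: x + x') y = a *: tensor x y + tensor x' y :> ptensor X Y.
  by apply: ptensor_ext => B; rewrite tensorE (let: And3 lB _ _ := bformP B in lB).
have tensorDr (a : R) x y y' :
    tensor x (a *: y + y') = a *: tensor x y + tensor x y' :> ptensor X Y.
  by apply: ptensor_ext => B; rewrite tensorE (let: And3 _ rB _ := bformP B in rB).
have tensorNl x y : tensor (- x) y = - tensor x y :> ptensor X Y.
  by apply: ptensor_ext => B; rewrite tensorE -scaleN1r bformZl mulN1r.
have [B BE] : exists B : bform X Y, forall x y, B x y = h (tensor x y).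
  apply: (@bounded_bilinear_bform _ _ _ _ 1).
  - by move=> y a x x'; rewrite tensorDl lh.
  - by move=> x a y y'; rewrite tensorDr lh.
  move=> x y; rewrite mul1r ler_norml htens andbT lerNl -hN -tensorNl.
  by rewrite -(normrN x).
have B1 : `|B| <= 1.
  apply: bform_norm_le => // x y; rewrite BE mul1r ler_norml htens andbT.
  by rewrite lerNl -hN -tensorNl -(normrN x).
have hc v : h v <= c * `|v|.
  apply: le_trans (hle v) _; apply: le_trans (relaxed_pi_le _ [::] c0) _.
  by rewrite /tcost /tsum !big_nil subr0 add0r.
have htsum s : h (tsum s) = tsum s B.
  by elim: s => [|p s IH]; rewrite ?tsum_cons ?hD ?IH -?BE// /tsum big_nil h0.
rewrite -hu; apply/ler_addgt0Pr => e e0.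
have ce : 0 < c + 1 by rewrite ltr_wpDl.
have [s su] := tsum_dense u (divr_gt0 e0 ce).
have -> : h u = h (u - tsum s) + (- (u - tsum s) B + u B).
  rewrite hD hN htsum [(u - _) B](_ : _ = u B - tsum s B)//; ring.
have uB : u B <= `|u|.
  apply: le_trans (ler_norm _) _; apply: le_trans (ptensor_le _ _) _.
  by rewrite ler_piMr.
have vB : - (u - tsum s) B <= `|u - tsum s|.
  apply: le_trans (ler_norm _) _; rewrite normrN; apply: le_trans (ptensor_le _ _) _.
  by rewrite ler_piMr.
rewrite addrA addrC lerD//.
apply: le_trans (lerD (hc _) vB) _.
by rewrite -[X in _ + X]mul1r -mulrDl mulrC -ler_pdivlMr// ltW.
Qed.

(** Taking c = r / d in [relaxed_pi_le_norm] makes a cost-plus-penalty below r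
    force both the cost below r and the distance below d. *)
Lemma tensor_approx u (r d : R) : `|u| < r -> 0 < d ->
  exists s, tcost s < r /\ `|u - tsum s| < d.
Proof.
move=> ur d0; have r0 : 0 < r := le_lt_trans (normr_ge0 u) ur.
have c0 : 0 < r / d by rewrite divr_gt0.
have /inf_lt := le_lt_trans (relaxed_pi_le_norm u (ltW c0)) ur.
move=> [|_ [s _ <-] sr].
  by exists (tcost [::] + r / d * `|u - tsum [::]|), [::].
exists s; split; first by apply: le_lt_trans sr; rewrite lerDl mulr_ge0// ltW.
have : r / d * `|u - tsum s| < r by apply: le_lt_trans sr; rewrite lerDr tcost_ge0.
by rewrite -ltr_pdivlMl// invf_div mulfVK// gt_eqF.
Qed.

End ProjectiveNorm.

(** * Control by compact sets *)

Section CompactControl.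
Context {R : realType}.

(** A filter that does not cluster at 0 avoids a ball around 0, hence lives on the
    finitely many points of the first few layers. *)
Lemma compact_shrinking (E : normedModType R) (k : nat -> seq E) (r : nat -> R) :
  r @ \oo --> 0 -> (forall n x, x \in k n -> `|x| <= r n) ->
  compact ([set 0] `|` \bigcup_n [set` k n]).
Proof.
move=> r0 kr F PF FK.
have [F0|nF0] := pselect (cluster F 0); first by exists 0; split=> //; left.
have [A [U [FA U0 AU]]] : exists A U, [/\ F A, nbhs 0 U & A `&` U = set0].
  apply: contrapT => H; apply: nF0 => A U FA U0; apply/set0P/eqP => AU.
  by apply: H; exists A, U.
have /nbhs_ballP[e /= e0 eU] := U0.
have [N _ rN] : \forall n \near \oo, r n < e by apply: cvgr_lt r0 _ e0.
pose G := \bigcup_(n in `I_N) [set` k n].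
have FG : F G.
  apply: filterS (filterI FA FK) => x [Ax [x0|[n _ kx]]].
    suff : (A `&` U) x by rewrite AU.
    by split=> //; rewrite x0; exact: nbhs_singleton U0.
  have [nN|nN] := ltnP n N; first by exists n.
  suff : (A `&` U) x by rewrite AU.
  split=> //; apply: eU; rewrite -ball_normE /= sub0r normrN.
  exact: le_lt_trans (kr _ _ kx) (rN _ nN).
have fG : finite_set G by apply: bigcup_finite => // n _; exact: finite_seq.
have [x [[n _ kx] Fx]] := finite_compact fG PF FG.
by exists x; split=> //; right; exists n.
Qed.

Lemma cvg_geometric0 (c z : R) : 0 <= z < 1 -> (fun n => c * z ^+ n) @ \oo --> 0.
Proof.
move=> /andP[z0 z1]; rewrite -[X in _ --> X](mulr0 c).
by apply: cvgMr; apply: cvg_expr; rewrite ger0_norm.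
Qed.

Context {X Y : normedModType R}.
Implicit Types (u : ptensor X Y) (B : bform X Y).

(** Iterating [tensor_approx] on the successive remainders. *)
Lemma ptensor_series u (r : nat -> R) : (forall n, 0 < r n) -> `|u| < r 0%N ->
  exists s : nat -> seq (X * Y), (forall n, tcost (s n) < r n) /\
    forall N, `|u - \sum_(n < N) tsum (s n)| < r N.
Proof.
move=> r0 ur.
have [|S SP] := @choice (nat * ptensor X Y) (seq (X * Y)) (fun p s => `|p.2| < r p.1 ->
    tcost s < r p.1 /\ `|p.2 - tsum s| < r p.1.+1).
  move=> -[n v] /=.
  have [vr|nvr] := pselect (`|v| < r n); last by exists [::].
  by have [s sP] := tensor_approx vr (r0 n.+1); exists s.
pose v := fix v n : ptensor X Y := if n is n'.+1 then v n' - tsum (S (n', v n')) else u.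
have vr n : `|v n| < r n.
  by elim: n => //= n IH; have [] := SP (n, v n) IH.
exists (fun n => S (n, v n)); split=> [n|N]; first by have [] := SP (n, v n) (vr n).
suff -> : u - \sum_(n < N) tsum (S (n : nat, v n)) = v N by [].
elim: N => [|N IH]; first by rewrite big_ord0 subr0.
by rewrite big_ord_recr /= opprD addrA IH.
Qed.

Lemma sum_geometric_half N : \sum_(n < N) (2^-1 : R) ^+ n <= 2.
Proof.
have -> : \sum_(n < N) (2^-1 : R) ^+ n = 2 - 2 * 2^-1 ^+ N.
  elim: N => [|N IH]; first by rewrite big_ord0 expr0; lra.
  by rewrite big_ord_recr /= IH exprS; lra.
by rewrite gerBl mulr_ge0// exprn_ge0// invr_ge0.
Qed.

(** In a series whose n-th block costs at most c / 8^n, both vectors of each tensor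
    of the block can be rescaled to norm at most 2^-n, so that together they form compact
    sets; this multiplies the weights by 4^n, and c 4^n / 8^n is still summable. *)
Lemma ptensor_compact_control u : exists (K : set X) (L : set Y) (M : R),
  [/\ compact K, compact L, (forall x, K x -> `|x| <= 1) /\ (forall y, L y -> `|y| <= 1),
   0 <= M &
   forall B (eta : R), (forall x y, K x -> L y -> `|B x y| <= eta) -> `|u B| <= M * eta].
Proof.
pose c := `|u| + 1; pose h : R := 2^-1.
have c0 : 0 < c by rewrite ltr_wpDl.
have h0 : 0 < h by rewrite invr_gt0.
have h1 : h < 1 by rewrite invf_lt1// ltr1n.
have hn1 n : h ^+ n <= 1 by rewrite exprn_ile1// ltW.
(* The ratio 1/8 leaves room for the factor 4^n of the rescaling. *)
pose r n := c * (h ^+ 3) ^+ n.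
have r0 n : 0 < r n by rewrite mulr_gt0// !exprn_gt0.
have ur : `|u| < r 0%N by rewrite /r expr0 mulr1 ltrDl ltr01.
have [s [sr us]] := ptensor_series r0 ur.
(* Since 0^-1 = 0, the zero vector is sent to 0. *)
pose nrm (E : normedModType R) n (x : E) : E := (h ^+ n * `|x|^-1) *: x.
have nrm_le E n x : `|nrm E n x| <= h ^+ n.
  rewrite normrZ normrM ger0_norm ?exprn_ge0 ?(ltW h0)// normfV normr_id -mulrA.
  have [->|x0] := eqVneq x 0; first by rewrite normr0 mulr0 mulr0 exprn_ge0// ltW.
  by rewrite mulVf ?normr_eq0// mulr1.
have nrmK E n x : (2 ^+ n * `|x|) *: nrm E n x = x.
  have [->|x0] := eqVneq x 0; first by rewrite /nrm !scaler0.
  rewrite scalerA mulrACA -exprMn divff ?pnatr_eq0// expr1n mul1r.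
  by rewrite divff ?scale1r// normr_eq0.
pose KX n := [seq nrm X n p.1 | p <- s n]; pose KY n := [seq nrm Y n p.2 | p <- s n].
have hcvg : (fun n => h ^+ n) @ \oo --> 0.
  by apply: cvg_expr; rewrite ger0_norm// ltW.
exists ([set 0] `|` \bigcup_n [set` KX n]), ([set 0] `|` \bigcup_n [set` KY n]), (2 * c).
split.
- by apply: compact_shrinking hcvg _ => n x /mapP[p _ ->].
- by apply: compact_shrinking hcvg _ => n x /mapP[p _ ->].
- split=> x [->|[n _ /mapP[p _ ->]]]; rewrite ?normr0//;
    exact: le_trans (nrm_le _ _ _) (hn1 n).
- by rewrite mulr_ge0// ltW.
move=> B eta Beta.
have eta0 : 0 <= eta by apply: le_trans (Beta 0 0 _ _); [|left|left].
have term n : `|tsum (s n) B| <= c * eta * h ^+ n.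
  rewrite tsumE; apply: le_trans (ler_norm_sum _ _ _) _.
  apply: (@le_trans _ _ (\sum_(p <- s n) 4 ^+ n * eta * (`|p.1| * `|p.2|))).
    rewrite big_seq [leRHS]big_seq; apply: ler_sum => p ps.
    rewrite -[in leLHS](nrmK X n p.1) -[in leLHS](nrmK Y n p.2) bformZ.
    rewrite normrM ger0_norm; last by rewrite !mulr_ge0// exprn_ge0.
    rewrite (_ : 4 = 2 * 2) ?exprMn; last by rewrite -natrM.
    have -> : 2 ^+ n * 2 ^+ n * eta * (`|p.1| * `|p.2|) =
        2 ^+ n * `|p.1| * (2 ^+ n * `|p.2|) * eta by ring.
    rewrite ler_wpM2l//.
    by apply: Beta; right; exists n => //; apply/mapP; exists p.
  rewrite -mulr_sumr -/(tcost (s n)).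
  apply: le_trans (ler_wpM2l _ (ltW (sr n))) _; first by rewrite mulr_ge0// exprn_ge0.
  rewrite /r -exprM.
  have -> : h ^+ (3 * n) = h ^+ n * h ^+ n * h ^+ n.
    by rewrite -!exprD; congr (_ ^+ _); rewrite mulSn mulSn mul1n addnA.
  have -> : 4 ^+ n * eta * (c * (h ^+ n * h ^+ n * h ^+ n)) =
      (4 ^+ n * (h ^+ n * h ^+ n)) * (c * eta * h ^+ n) by ring.
  rewrite -!exprMn (_ : 4 * (h * h) = 1) ?expr1n ?mul1r//.
  by rewrite /h; lra.
apply/ler_addgt0Pr => e e0.
have hh : 0 <= h ^+ 3 < 1 by rewrite exprn_ge0 ?(ltW h0)//= exprn_ilt1// ltW.
have [N _ /(_ N (leqnn N)) /= rN] : \forall n \near \oo, c * `|B| * (h ^+ 3) ^+ n < e.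
  exact: (@cvgr_lt _ _ _ _ _ _ (cvg_geometric0 (c * `|B|) hh)).
have -> : u B = (u - \sum_(n < N) tsum (s n)) B + \sum_(n < N) tsum (s n) B.
  have sumB : (\sum_(n < N) tsum (s n)) B = \sum_(n < N) tsum (s n) B.
    elim: (N) => [|m IH]; first by rewrite !big_ord0.
    by rewrite !big_ord_recr /= -IH.
  by rewrite -sumB [X in X + _](_ : _ = u B - (\sum_(n < N) tsum (s n)) B)// subrK.
apply: le_trans (ler_normD _ _) _; rewrite addrC lerD//.
  apply: le_trans (ler_norm_sum _ _ _) _.
  apply: (@le_trans _ _ (\sum_(n < N) c * eta * h ^+ n)).
    by apply: ler_sum => n _; exact: term.
  rewrite -mulr_sumr -[leRHS]mulrA [leRHS]mulrC ler_wpM2l//.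
    by rewrite mulr_ge0// ltW.
  exact: sum_geometric_half.
apply: le_trans (ptensor_le _ _) _; apply: le_trans (ltW rN).
by rewrite mulrAC ler_wpM2r// ltW.
Qed.

End CompactControl.

(** * Slices of a tensor *)

Section Slices.
Context {R : realType} {X Y : normedModType R} {Z : completeNormedModType R}.

(** The two slices of a tensor, u (- # g) and u (f # -), are treated at once: Phi
    is the partial application of [rank1]. Finite sums of elementary tensors have
    slices that are evaluations at points of Z; a norming functional turns the
    convergence of the sums to u into the Cauchy property of these points. *)
Lemma ptensor_slice (Phi : dual Z -> bform X Y) (c : R) (z : X -> Y -> Z) :
  (forall f, `|Phi f| <= c * `|f|) -> (forall f x y, Phi f x y = f (z x y)) ->
  forall u : ptensor X Y, exists w : Z, forall f, u (Phi f) = f w.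
Proof.
move=> Phic Phiz u.
have h0 n : (0 : R) < n.+1%:R^-1 by rewrite invr_gt0.
have [s sP] := choice (fun n => tsum_dense u (h0 n)).
pose w n := \sum_(p <- s n) z p.1 p.2.
have fw (f : dual Z) n : f (w n) = tsum (s n) (Phi f).
  by rewrite tsumE linear_sum; apply: eq_bigr => p _; rewrite Phiz.
have uw (f : dual Z) n : `|u (Phi f) - f (w n)| <= `|c| * `|f| * n.+1%:R^-1.
  rewrite fw (_ : _ - _ = (u - tsum (s n)) (Phi f))//.
  apply: le_trans (ptensor_le _ _) _; rewrite mulrC.
  rewrite ler_pM ?(ltW (sP n))//; apply: le_trans (Phic f) _.
  by rewrite ler_wpM2r// ler_norm.
have n0 : (fun n => `|c| * n.+1%:R^-1 : R) @ \oo --> 0.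
  by rewrite -[X in _ --> X](mulr0 `|c|); apply: cvgMr; exact: cvg_harmonic.
have wcauchy : cauchy (w @ \oo).
  apply: cauchy_exP => e e0; have e20 : 0 < e / 2 by rewrite divr_gt0.
  have [N _ NP] : \forall n \near \oo, `|c| * n.+1%:R^-1 < e / 2.
    exact: (@cvgr_lt _ _ _ _ _ _ n0).
  exists (w N); exists N => // n /= Nn; rewrite -ball_normE /=.
  have [f [f1 <-]] := norming_functional (w N - w n).
  rewrite linearB -[X in X < _]opprK; apply: le_lt_trans (ler_norm _) _.
  have -> : - - (f (w N) - f (w n)) = (u (Phi f) - f (w n)) - (u (Phi f) - f (w N)).
    ring.
  apply: le_lt_trans (ler_normB _ _) _; rewrite [ltRHS]splitr.
  have bnd m : (N <= m)%N -> `|u (Phi f) - f (w m)| < e / 2.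
    move=> Nm; apply: le_lt_trans (uw f m) _; apply: le_lt_trans (NP m Nm).
    by rewrite ler_wpM2r ?ler_piMr// ltW.
  by rewrite ltrD// bnd.
have /cvg_ex[/= l wl] : cvg (w @ \oo) by apply/cauchy_cvgP.
exists l => f; apply/eqP; rewrite -subr_eq0 -normr_le0.
have [_ /(_ l) fc] := dualP f.
have fwl : (fun n => f (w n)) @ \oo --> f l by apply: continuous_cvg.
have H1 : (fun n => `|u (Phi f) - f (w n)|) @ \oo --> `|u (Phi f) - f l|.
  by apply: cvg_norm; apply: cvgB => //; exact: cvg_cst.
have H2 : (fun n => `|f| * (`|c| * n.+1%:R^-1)) @ \oo --> 0.
  by rewrite -[X in _ --> X](mulr0 `|f|); apply: cvgMr.
apply: (ler_cvg_to H1 H2); apply: nearW => n.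
by apply: le_trans (uw f n) _; rewrite mulrA [`|c| * _]mulrC.
Qed.

End Slices.

(** * Finite-rank operators *)

Section FiniteRank.
Context {R : realType}.

(** Induction on a spanning sequence. A functional k with k e = 1 splits the
    component k (G x) e off G x, and z |-> z - k z e maps the span of e :: s into
    the span of the images of s. Choosing k by Hahn-Banach makes the coefficient
    functionals bounded without any appeal to equivalence of norms in finite
    dimension. *)
Lemma finite_rank_decomposition (E F : normedModType R) (s : seq F) (c : R) (G : E -> F) :
  linear G -> (forall x, `|G x| <= c * `|x|) -> (forall x, lspan [set` s] (G x)) ->
  exists t : seq (dual E * F), forall x, G x = \sum_(p <- t) p.1 x *: p.2.
Proof.
move: c G; elim: {s}(size s) {-2}s (erefl (size s)) => [|n IH] [|e s] //=
  => [_|[sn]] c G lG Gc Gs.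
  exists [::] => x; rewrite big_nil; have [[|p t] [tP ->]] := Gs x.
    by rewrite big_nil.
  by have := tP p (mem_head _ _).
(* For e = 0 the convention 0^-1 = 0 makes k = 0 and P the identity. *)
have [h [h1 he]] := norming_functional e.
pose k z := h z * `|e|^-1; pose P z := z - k z *: e.
have Pe : P e = 0.
  rewrite /P /k he; have [->|e0] := eqVneq e 0; first by rewrite scaler0 subr0.
  by rewrite divff ?normr_eq0// scale1r subrr.
have lk (a : R) y z : k (a *: y + z) = a * k y + k z.
  by rewrite /k linearP /= mulrDl mulrA.
have lP : linear P.
  by move=> a y z; rewrite /P lk scalerDl -scalerA scalerBr opprD addrACA.
have P0 : P 0 = 0.
  by apply: (addrI (P 0)); rewrite -{1}[P 0]scale1r -lP scaler0 !addr0.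
have kc z : `|k z| <= `|e|^-1 * `|z|.
  rewrite normrM normfV normr_id mulrC ler_wpM2l ?invr_ge0//.
  by apply: le_trans (dual_le _ _) _; rewrite ler_piMl.
have Pc z : `|P z| <= 2 * `|z|.
  rewrite (le_trans (ler_normB _ _))// mulr_natl mulr2n lerD2l normrZ.
  have [->|e0] := eqVneq e 0; first by rewrite normr0 mulr0.
  rewrite -ler_pdivlMr ?normr_gt0// mulrC; exact: kc.
have [||f fE] := @bounded_linear_dual _ _ (fun x => k (G x)) (`|e|^-1 * c).
- by move=> a x y; rewrite lG lk.
- move=> x; apply: le_trans (kc _) _; rewrite -mulrA ler_wpM2l ?invr_ge0//.
have [||||t tE] := IH [seq P z | z <- s] _ (2 * c) (P \o G).
- by rewrite size_map.
- by move=> a x y; rewrite /= lG lP.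
- by move=> x; apply: le_trans (Pc _) _; rewrite -mulrA ler_wpM2l.
- move=> x /=; have [q [qP ->]] := Gs x.
  elim: q qP => [|p q IHq] qP; first by rewrite big_nil P0; exact: lspan0.
  rewrite big_cons lP; apply: lspanD; last first.
    by apply: IHq => r rq; apply: qP; rewrite inE rq orbT.
  apply: lspanZ; have /= := qP p (mem_head _ _); rewrite inE => /predU1P[->|ps].
    by rewrite Pe; exact: lspan0.
  by apply: sub_lspan => /=; exact: map_f.
exists ((f, e) :: t) => x; rewrite big_cons /= -tE fE /= /P.
by rewrite addrC subrK.
Qed.

Lemma finite_rank_operator (E : normedModType R) (T : {linear E -> E}) :
  bounded_near T (nbhs 0) -> finite_rank T ->
  exists (r : R) (t : seq (dual E * E)), [/\ 0 <= r, forall x, `|T x| <= r * `|x| &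
    forall x, T x = \sum_(p <- t) p.1 x *: p.2].
Proof.
move=> /linear_boundedP/pinfty_ex_gt0[r r0 rT] [s Ts].
have [|||t tE] := @finite_rank_decomposition E E s r T; first exact: linearP.
- exact: rT.
- by move=> x; rewrite -Ts; exists x.
by exists r, t; split=> //; exact: ltW.
Qed.

End FiniteRank.

(** * Rank-one forms separate points under the approximation property *)

Section Separation.
Context {R : realType} {X Y : normedModType R}.
Implicit Types (u : ptensor X Y) (B : bform X Y).

Lemma ptensorD u B C : u (B + C) = u B + u C.
Proof. exact: raddfD. Qed.

Lemma bform_left B y : exists f : dual X, forall x, f x = B x y.
Proof.
apply: (@bounded_linear_dual _ _ _ (`|B| * `|y|)).
  by have [lB _ _] := bformP B; exact: lB.
by move=> x; rewrite mulrAC; exact: norm_bform_le.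
Qed.

Lemma bform_right B x : exists g : dual Y, forall y, g y = B x y.
Proof.
apply: (@bounded_linear_dual _ _ _ (`|B| * `|x|)); last by move=> y; exact: norm_bform_le.
by have [_ rB _] := bformP B; exact: rB.
Qed.

Lemma vanish_finite_rank u B (t : seq (dual X * dual Y)) :
  (forall f g, u (rank1 f g) = 0) ->
  (forall x y, B x y = \sum_(p <- t) p.1 x * p.2 y) -> u B = 0.
Proof.
move=> u0; elim: t B => [|p t IH] B BE.
  suff -> : B = 0 by exact: raddf0.
  by apply: bform_ext => x y; rewrite BE big_nil.
rewrite -[B](subrK (rank1 p.1 p.2)) ptensorD u0 addr0; apply: IH => x y.
rewrite [LHS](_ : _ = B x y - rank1 p.1 p.2 x y)//.
by rewrite BE big_cons rank1E addrC addKr.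
Qed.

(** The form C approximating B may depend on the compact sets; in the applications
    it is B composed with a finite-rank operator in one variable. *)
Lemma vanish_of_approx u :
  (forall (K : set X) (L : set Y) (e : R), compact K -> compact L ->
     (forall x, K x -> `|x| <= 1) -> (forall y, L y -> `|y| <= 1) -> 0 < e ->
     forall B, exists C, u C = 0 /\ forall x y, K x -> L y -> `|B x y - C x y| <= `|B| * e) ->
  u = 0.
Proof.
move=> H; apply: ptensor_ext => B; rewrite [RHS](_ : _ = 0)//.
have [K [L [M [cK cL [K1 L1] M0 MP]]]] := ptensor_compact_control u.
apply/eqP; rewrite -normr_le0; apply/ler_addgt0Pr => e e0; rewrite add0r.
have d0 : 0 < M * `|B| + 1 by rewrite ltr_wpDl// mulr_ge0.
have [C [uC BC]] := H K L _ cK cL K1 L1 (divr_gt0 e0 d0) B.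
have := MP (B - C) (`|B| * (e / (M * `|B| + 1))) BC.
have -> : u (B - C) = u B by rewrite raddfB /= uC subr0.
move=> /le_trans; apply; rewrite mulrA mulrCA ger_pMr// ler_pdivrMr// mul1r lerDl//.
Qed.

(** If T is a finite-rank operator on X, then B (T x) y is the sum of the
    f x * B e y over a decomposition of T into terms f(-) e, a combination of
    rank-one forms; likewise in the second variable. *)
Theorem rank1_separating : approximation_property X \/ approximation_property Y ->
  forall u, (forall f g, u (rank1 f g) = 0) -> u = 0.
Proof.
move=> AP u u0; apply: vanish_of_approx => K L e cK cL K1 L1 e0 B.
have [lB rB _] := bformP B.
case: AP => [/(_ e K e0 cK)|/(_ e L e0 cL)] [T [Tb Tf Te]].
- have [r [t [r0 rT tE]]] := finite_rank_operator Tb Tf.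
  have [|||C CE] := @bounded_bilinear_bform _ _ _ (fun x y => B (T x) y) (`|B| * r).
  + by move=> y a x x'; rewrite linearP lB.
  + by move=> x; exact: rB.
  + move=> x y; apply: le_trans (norm_bform_le _ _ _) _.
    by rewrite ler_wpM2r// -mulrA ler_wpM2l.
  exists C; split; last first.
    move=> x y Kx Ly; rewrite CE.
    have -> : B x y - B (T x) y = B (x - T x) y by rewrite addrC -scaleN1r -lB scaleN1r addrC.
    apply: le_trans (norm_bform_le _ _ _) _; rewrite -mulrA ler_wpM2l//.
    by rewrite -[leRHS]mulr1 ler_pM ?L1// distrC Te.
  have [g gE] := choice (bform_right B).
  apply: (@vanish_finite_rank _ _ [seq (p.1, g p.2) | p <- t]) => // x y.
  rewrite CE tE big_map; elim: (t) => [|p q IH].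
    by rewrite !big_nil -(scale0r (0 : X)) bformZl mul0r.
  by rewrite !big_cons lB IH /= gE.
- have [r [t [r0 rT tE]]] := finite_rank_operator Tb Tf.
  have [|||C CE] := @bounded_bilinear_bform _ _ _ (fun x y => B x (T y)) (`|B| * r).
  + by move=> y; exact: lB.
  + by move=> x a y y'; rewrite linearP rB.
  + move=> x y; apply: le_trans (norm_bform_le _ _ _) _.
    by rewrite mulrAC [leRHS]mulrAC ler_wpM2r// -mulrA ler_wpM2l.
  exists C; split; last first.
    move=> x y Kx Ly; rewrite CE.
    have -> : B x y - B x (T y) = B x (y - T y) by rewrite addrC -scaleN1r -rB scaleN1r addrC.
    apply: le_trans (norm_bform_le _ _ _) _; rewrite -mulrA ler_wpM2l//.
    by rewrite -[leRHS]mul1r ler_pM ?K1// distrC Te.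
  have [f fE] := choice (bform_left B).
  apply: (@vanish_finite_rank _ _ [seq (f p.2, p.1) | p <- t]) => // x y.
  rewrite CE tE big_map; elim: (t) => [|p q IH].
    by rewrite !big_nil -(scale0r (0 : Y)) -[x]scale1r bformZ mulr0 mul0r.
  by rewrite !big_cons rB IH /= fE mulrC.
Qed.

End Separation.

(** * Weak closedness of the set of elementary tensors *)

Section WeakTopology.
Context {R : realType} (E : normedModType R).

(** The weak topology is a supremum, so convergence in it is convergence in each of
    the initial topologies. *)
Lemma weak_continuous (f : dual E) : continuous (f : weak E -> R).
Proof.
move=> x; have /cvg_sup/(_ f) H : nbhs (x : weak E) --> (x : weak E) by [].
apply: (cvg_trans (cvg_app f H)).
exact: (@initial_continuous E R f x).
Qed.

End WeakTopology.

Lemma ptensor_eval_dual (R : realType) (X Y : normedModType R) (B : bform X Y) :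
  exists F : dual (ptensor X Y), forall u, F u = u B.
Proof.
apply: (@bounded_linear_dual _ _ _ `|B|); first by move=> a u v.
by move=> u; rewrite mulrC; exact: ptensor_le.
Qed.

(** The minors with f0 and g0 read u (f # g) = u (f # g0) u (f0 # g) / u (f0 # g0);
    the two factors are evaluations at x and y by [ptensor_slice], and agreement
    on all f # g is enough by [rank1_separating]. *)
Lemma tensor_minors (R : realType) (X Y : completeNormedModType R) :
  approximation_property X \/ approximation_property Y ->
  forall u : ptensor X Y, (exists x y, u = tensor x y) <->
  forall f g f' g', u (rank1 f g) * u (rank1 f' g') = u (rank1 f g') * u (rank1 f' g).
Proof.
move=> AP u; split=> [[x [y ->]] f g f' g'|minors].
  by rewrite !tensorE !rank1E; ring.
have [u0|/existsNP[f0 /existsNP[g0 /eqP u0]]] := pselect (forall f g, u (rank1 f g) = 0).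
  exists 0, 0; rewrite (rank1_separating AP u0).
  apply: ptensor_ext => B; rewrite tensorE.
  by rewrite -(scale0r (0 : X)) bformZl mul0r.
have [x xE] : exists x : X, forall f, u (rank1 f g0) = f x.
  apply: (@ptensor_slice _ _ _ _ (rank1^~ g0) `|g0| (fun x y => g0 y *: x)).
    by move=> f; rewrite mulrC; exact: rank1_norm.
  by move=> f x y; rewrite rank1E linearZ mulrC.
have [y yE] : exists y : Y, forall g, u (rank1 f0 g) = g y.
  apply: (@ptensor_slice _ _ _ _ (rank1 f0) `|f0| (fun x y => f0 x *: y)).
    by move=> f; exact: rank1_norm.
  by move=> g x' y; rewrite rank1E linearZ.
exists x, ((u (rank1 f0 g0))^-1 *: y); apply/eqP; rewrite -subr_eq0; apply/eqP.
apply: (rank1_separating AP) => f g.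
rewrite [LHS](_ : _ = u (rank1 f g) - tensor x ((u (rank1 f0 g0))^-1 *: y) (rank1 f g))//.
rewrite tensorE rank1E [X in f x * X]linearZ /= -(xE f) -(yE g).
apply/eqP; rewrite subr_eq0; apply/eqP.
apply: (mulIf u0); rewrite minors -[RHS]mulrA; congr (_ * _).
by rewrite [RHS]mulrC [RHS]mulrA divff// mul1r.
Qed.

Theorem proposition1p2 (R : realType) (X Y : completeNormedModType R)
  (hAP : approximation_property X \/ approximation_property Y) :
  weakly_closed [set u : ptensor X Y | exists (x : X) (y : Y), u = tensor x y].
Proof.
have [F FE] := choice (@ptensor_eval_dual R X Y).
rewrite /weakly_closed.
pose D (q : (dual X * dual Y) * (dual X * dual Y)) (u : weak (ptensor X Y)) : R :=
  F (rank1 q.1.1 q.1.2) u * F (rank1 q.2.1 q.2.2) u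
  - F (rank1 q.1.1 q.2.2) u * F (rank1 q.2.1 q.1.2) u.
have -> : [set u : ptensor X Y | exists (x : X) (y : Y), u = tensor x y] =
    \bigcap_q (D q @^-1` [set 0]).
  apply/seteqP; split=> u /=.
    move=> /(tensor_minors hAP) uP [[f g] [f' g']] _.
    by rewrite /D /= !FE uP subrr.
  move=> uP; apply/(tensor_minors hAP) => f g f' g'.
  have := uP ((f, g), (f', g')) I; rewrite /D /= !FE => /eqP.
  by rewrite subr_eq0 => /eqP.
apply: closed_bigI => q _; apply: preimage_closed; last exact: closed_eq.
move=> u _; have cF B : {for u, continuous (F B : weak (ptensor X Y) -> R)}.
  exact: weak_continuous.
exact: (continuousB (continuousM (cF _) (cF _)) (continuousM (cF _) (cF _))).
Qed.
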